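(* Let $G_1,G_2$ be generators over $\Sigma_1,\Sigma_2$, let $\Sigma_1\cap\Sigma_2\subseteq\Sigma_k\subseteq\Sigma:=\Sigma_1\cup\Sigma_2$, and let $G_k=P_k(G_1)\|P_k(G_2)$ be the coordinator over $\Sigma_k$; assume $G_1$ and $G_2$ are conditionally independent with respect to $G_k$. Let $K\subseteq L_m(G_1\|G_2\|G_k)$ be a language such that $K$ and $\overline{K}$ are conditionally decomposable with respect to $\Sigma_1,\Sigma_2,\Sigma_k$. Define $$\mathrm{supC}_k=\mathrm{supC}(P_k(K),L(G_k),\Sigma_{k,u}),\qquad \mathrm{supC}_{i+k}=\mathrm{supC}(P_{i+k}(K),L(G_i)\|\overline{\mathrm{supC}_k},\Sigma_{i+k,u}),\quad i=1,2.$$ Let $\Sigma_k\subseteq\Sigma_0\subseteq\Sigma$ be such that the projection $P_0$ to $\Sigma_0^*$ is a $\mathrm{supC}_{i+k}$-observer for $i=1,2$, and let $$L_C=\mathrm{supC}\bigl(P_0(\mathrm{supC}_{1+k})\|P_0(\mathrm{supC}_{2+k}),\ \overline{P_0(\mathrm{supC}_{1+k})}\|\overline{P_0(\mathrm{supC}_{2+k})},\ \Sigma_{0,u}\bigr).$$ Then $$\overline{\mathrm{supC}_{1+k}\|\mathrm{supC}_{2+k}\|L_C}=\overline{\mathrm{supC}_{1+k}}\,\|\,\overline{\mathrm{supC}_{2+k}}\,\|\,\overline{L_C},$$ and this language is controllable with respect to $L(G_1)\|L(G_2)$ and $\Sigma_u$.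
   Context: A generator $G=(Q,\Sigma,f,q_0,Q_m)$ is a deterministic finite automaton with partial transition function; $L(G)$ is the set of words $s$ with $f(q_0,s)$ defined and $L_m(G)$ those with $f(q_0,s)\in Q_m$. Languages given as data are regular. $\overline{M}$ is the prefix closure of $M$. $\Sigma_u\subseteq\Sigma$ is the set of uncontrollable events, $\Sigma_{j,u}=\Sigma_j\cap\Sigma_u$ for $j=1,2,k,0$, and $\Sigma_{i+k,u}=(\Sigma_i\cup\Sigma_k)\cap\Sigma_u$. Projections erase events outside the target event set: $P_k$ maps to $\Sigma_k^*$, $P_0$ to $\Sigma_0^*$, and $P_{i+k}$ to $(\Sigma_i\cup\Sigma_k)^*$; they are also applied to words over subsets of $\Sigma$, and the projection of a language over $A\subseteq\Sigma$ to $\Sigma_0$ is regarded as a language over $A\cap\Sigma_0$ (similarly for $P_k$). The projected generator $P(G)$ is a generator with $L(P(G))=P(L(G))$ and $L_m(P(G))=P(L_m(G))$. The synchronous product of languages $L_i$ over $A_i$ is the set of words over $\bigcup_iA_i$ whose projection to $A_i^*$ is in $L_i$ for every $i$; $\mathrm{supC}_{i+k}$ is over $\Sigma_i\cup\Sigma_k$ and $L_C$ over $\Sigma_0$. $L(G\|G')=L(G)\|L(G')$ and $L_m(G\|G')=L_m(G)\|L_m(G')$. Conditional independence of $G_1,G_2$ with respect to $G_k$: $\Sigma_r(G_1)\cap\Sigma_r(G_2)\subseteq\Sigma_r(G_k)$, where $\Sigma_r(G)$ is the set of events occurring in words of $L(G)$. A language $M\subseteq\Sigma^*$ is conditionally decomposable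 with respect to $\Sigma_1,\Sigma_2,\Sigma_k$ if $M=P_{1+k}(M)\|P_{2+k}(M)$. $M$ is controllable with respect to a prefix-closed language $N$ and event set $U$ if $\overline{M}U\cap N\subseteq\overline{M}$. $\mathrm{supC}(M,N,U)$ is the union of all languages $M'\subseteq M\cap N$ controllable with respect to $N$ and $U$. A projection $P$ on words over $A$ is an $M$-observer for $M\subseteq A^*$ if for all $t\in P(M)$ and $s\in\overline{M}$ such that $P(s)$ is a prefix of $t$, there is $u\in A^*$ with $su\in M$ and $P(su)=t$. *)

(* Defs.v *)
From mathcomp Require Import all_boot.
From mathcomp Require Import boolp classical_sets.

Set Implicit Arguments.
Unset Strict Implicit.
Unset Printing Implicit Defensive.

Local Open Scope classical_set_scope.

(* Alphabets are finite subsets A : {set E} of a finite universe E of events,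
   so that words over different alphabets live in the common type seq E.
   Languages need not be decidable, hence Prop-valued sets. *)

Definition language (E : finType) := set (seq E).

Section Languages.
Variable E : finType.
Implicit Types (A B T U : {set E}) (M N : language E) (s t u : seq E).

Definition words A : language E := [set s | all (mem A) s].

(* A word over A is projected to (A :&: T)^*, since events outside T are
   erased; projecting a language over A yields one over A :&: T. *)
Definition proj T s : seq E := [seq a <- s | a \in T].

Definition lproj T M : language E := proj T @` M.

Definition prefix_closure M : language E := [set s | exists u, M (s ++ u)].

(* The product depends on the alphabets, which are therefore explicit. *)
Definition sync A M B N : language E :=
  [set s | words (A :|: B) s /\ M (proj A s) /\ N (proj B s)].

Definition cond_decomposable A1 A2 Ak M : Prop :=
  M = sync (A1 :|: Ak) (lproj (A1 :|: Ak) M) (A2 :|: Ak) (lproj (A2 :|: Ak) M).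

Definition controllable M N U : Prop :=
  [set rcons s a | s in prefix_closure M & a in [set` U]] `&` N
    `<=` prefix_closure M.

Definition supC M N U : language E :=
  \bigcup_(M' in [set M' | M' `<=` M `&` N /\ controllable M' N U]) M'.

(* The projection onto T, on words over A, is an M-observer (M `<=` words A). *)
Definition observer A T M : Prop :=
  forall t s, lproj T M t -> prefix_closure M s -> prefix (proj T s) t ->
    exists u, [/\ words A u, M (s ++ u) & proj T (s ++ u) = t].

End Languages.

Record generator (E : finType) := Generator {
  gen_state : finType;
  gen_events : {set E};
  gen_trans : gen_state -> E -> option gen_state;
  gen_init : gen_state;
  gen_marked : {set gen_state};
  gen_transP : forall q a, gen_trans q a != None -> a \in gen_events }.

Section Generators.
Variable E : finType.
Implicit Types (G H : generator E) (T : {set E}) (M : language E).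

Definition gen_run G (q : gen_state G) (s : seq E) : option (gen_state G) :=
  foldl (fun oq a => obind (fun p => gen_trans p a) oq) (Some q) s.

Definition gen_lang G : language E :=
  [set s | exists q, gen_run (gen_init G) s = Some q].

Definition gen_mlang G : language E :=
  [set s | exists2 q, gen_run (gen_init G) s = Some q & q \in gen_marked G].

Definition regular M : Prop := exists G, gen_mlang G = M.

Definition occurring_events G : set E :=
  [set a | exists2 s, gen_lang G s & a \in s].

Definition cond_independent G1 G2 Gk : Prop :=
  occurring_events G1 `&` occurring_events G2 `<=` occurring_events Gk.

Definition is_projected_generator T G PG : Prop :=
  [/\ gen_events PG = gen_events G :&: T,
      gen_lang PG = lproj T (gen_lang G)
    & gen_mlang PG = lproj T (gen_mlang G)].

(* A component stays put on the events outside its alphabet. *)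
Definition local_step G (q : gen_state G) (a : E) : option (gen_state G) :=
  if a \in gen_events G then gen_trans q a else Some q.

Definition sync_trans G H (p : gen_state G * gen_state H) (a : E) :
    option (gen_state G * gen_state H) :=
  if a \in gen_events G :|: gen_events H then
    if (local_step p.1 a, local_step p.2 a) is (Some q1, Some q2)
    then Some (q1, q2) else None
  else None.

Lemma sync_transP G H p a :
  @sync_trans G H p a != None -> a \in gen_events G :|: gen_events H.
Proof. by rewrite /sync_trans; case: ifP. Qed.

Definition sync_gen G H : generator E :=
  Generator (gen_init G, gen_init H) (finset.setX (gen_marked G) (gen_marked H))
    (@sync_transP G H).

Lemma gen_run_rcons G (q : gen_state G) s a :
  gen_run q (rcons s a) = obind (fun p => gen_trans p a) (gen_run q s).
Proof. by rewrite /gen_run -cats1 foldl_cat. Qed.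

Lemma proj_rcons T s a :
  proj T (rcons s a) = if a \in T then rcons (proj T s) a else proj T s.
Proof. by rewrite /proj filter_rcons. Qed.

Lemma sync_gen_run G H s :
  gen_run (gen_init (sync_gen G H)) s =
    if all (mem (gen_events G :|: gen_events H)) s then
      if (gen_run (gen_init G) (proj (gen_events G) s),
          gen_run (gen_init H) (proj (gen_events H) s)) is (Some q1, Some q2)
      then Some (q1, q2) else None
    else None.
Proof.
elim/last_ind: s => [//|s a IHs]; rewrite gen_run_rcons IHs all_rcons /=.
rewrite !proj_rcons; case: (all _ s); rewrite ?andbF ?andbT //.
rewrite finset.in_setU; case aG: (a \in gen_events G); case aH: (a \in gen_events H);
  rewrite /= ?gen_run_rcons;
  case: (gen_run _ (proj (gen_events G) s)) => [q1|] //=;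
  case: (gen_run _ (proj (gen_events H) s)) => [q2|] //=;
  rewrite /sync_trans /local_step ?finset.in_setU /= ?aG ?aH //=;
  by case: (gen_trans q1 a).
Qed.

Lemma gen_lang_sync G H :
  gen_lang (sync_gen G H) =
    sync (gen_events G) (gen_lang G) (gen_events H) (gen_lang H).
Proof.
apply/seteqP; split=> s; rewrite /gen_lang /sync /words /= sync_gen_run.
  case: ifP => [_|_ []//]; case: (gen_run _ (proj (gen_events G) s)) => [q1|];
    last by case.
  case: (gen_run _ (proj (gen_events H) s)) => [q2|]; last by case.
  by move=> _; split=> //; split; [exists q1 | exists q2].
by move=> [-> [[q1 ->] [q2 ->]]]; exists (q1, q2).
Qed.

Lemma gen_mlang_sync G H :
  gen_mlang (sync_gen G H) =
    sync (gen_events G) (gen_mlang G) (gen_events H) (gen_mlang H).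
Proof.
apply/seteqP; split=> s; rewrite /gen_mlang /sync /words /= sync_gen_run.
  case: ifP => [_|_ []//]; case: (gen_run _ (proj (gen_events G) s)) => [q1|];
    last by case.
  case: (gen_run _ (proj (gen_events H) s)) => [q2|]; last by case.
  case=> _ [<-]; rewrite finset.in_setX => /andP[m1 m2].
  by split=> //; split; [exists q1 | exists q2].
move=> [-> [[q1 -> m1] [q2 -> m2]]]; exists (q1, q2) => //.
by rewrite finset.in_setX m1.
Qed.

(* Subset construction, showing that projected generators exist. *)
Section Subset.
Variables (T : {set E}) (G : generator E).
Implicit Types (q r : gen_state G) (X : {set gen_state G}) (t w : seq E).

Definition silent q r := [exists a, (a \notin T) && (gen_trans q a == Some r)].

Definition subset_init : {set gen_state G} :=
  [set r | connect silent (gen_init G) r]%SET.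

Definition subset_step X a : {set gen_state G} :=
  [set r | (a \in T) && [exists q in X, exists q',
              (gen_trans q a == Some q') && connect silent q' r]]%SET.

Definition subset_trans X a : option {set gen_state G} :=
  if subset_step X a != finset.set0 then Some (subset_step X a) else None.

Lemma subset_transP X a : subset_trans X a != None -> a \in gen_events G :&: T.
Proof.
rewrite /subset_trans; case: ifP => // /set0Pn[r]; rewrite !inE.
case/andP=> aT /existsP[q /andP[_ /existsP[q' /andP[/eqP qa _]]]] _.
by rewrite aT andbT (@gen_transP _ G q) // qa.
Qed.

Definition subset_gen : generator E :=
  Generator subset_init [set X | X :&: gen_marked G != finset.set0]%SET
    subset_transP.

Lemma connect_silentP q r :
  connect silent q r <-> exists2 w, gen_run q w = Some r & proj T w = [::].
Proof.
split.
  case/connectP=> p; elim/last_ind: p r => [|p x IHp] r.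
    by move=> _ ->; exists [::].
  rewrite rcons_path last_rcons => /andP[pp /existsP[a /andP[aT /eqP xa]]] ->.
  have [w wr wT] := IHp _ pp erefl; exists (rcons w a).
    by rewrite gen_run_rcons wr.
  by rewrite proj_rcons (negbTE aT).
case=> w; elim/last_ind: w r => [|w a IHw] r; first by case=> ->.
rewrite gen_run_rcons proj_rcons; case E1: (gen_run q w) => [p|] //= pa.
case: ifP => aT wT; first by case: (proj T w) wT.
apply: connect_trans (IHw _ E1 wT) _; apply: connect1.
by apply/existsP; exists a; rewrite aT pa /=.
Qed.

Lemma gen_run_cat q s1 s2 :
  gen_run q (s1 ++ s2) = obind (fun p => gen_run p s2) (gen_run q s1).
Proof.
rewrite /gen_run foldl_cat; case: (foldl _ _ s1) => //=.
by elim: s2.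
Qed.

Lemma proj_split w t a : proj T w = rcons t a ->
  exists w1 w2, [/\ w = w1 ++ a :: w2, a \in T, proj T w1 = t
                  & proj T w2 = [::]].
Proof.
elim/last_ind: w => [|w b IHw]; first by case: t.
rewrite proj_rcons; case: ifP => bT.
  by move/rcons_inj=> [<- <-]; exists w, [::]; rewrite cats1.
case/IHw=> w1 [w2 [-> aT w1t w2n]]; exists w1, (rcons w2 b).
by rewrite proj_rcons bT rcons_cat.
Qed.

Lemma mem_subset t r :
  r \in foldl subset_step subset_init t <->
  exists2 w, gen_run (gen_init G) w = Some r & proj T w = t.
Proof.
elim/last_ind: t r => [|t a IHt] r; first by rewrite inE; apply: connect_silentP.
rewrite -cats1 foldl_cat /= cats1 inE; split.
  case/andP=> aT /existsP[q /andP[/IHt[w wq wt] /existsP[q' /andP[/eqP qa]]]].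
  case/connect_silentP=> w2 w2r w2n; exists (rcons w a ++ w2).
    by rewrite gen_run_cat gen_run_rcons wq /= qa.
  by rewrite /proj filter_cat -!/(proj _ _) proj_rcons aT w2n cats0 wt.
case=> w wr /proj_split[w1 [w2 [ew aT w1t w2n]]].
move: wr; rewrite ew -cat_rcons gen_run_cat gen_run_rcons.
case E1: (gen_run _ w1) => [q|] //=.
case E2: (gen_trans q a) => [q'|] //= w2r.
rewrite aT; apply/existsP; exists q; apply/andP; split.
  by apply/IHt; exists w1.
by apply/existsP; exists q'; rewrite E2 eqxx; apply/connect_silentP; exists w2.
Qed.

Lemma subset_gen_run t :
  gen_run (gen_init subset_gen) t =
    if foldl subset_step subset_init t != finset.set0
    then Some (foldl subset_step subset_init t) else None.
Proof.
elim/last_ind: t => [|t a IHt].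
  rewrite /=; case: ifP => // /negbFE/eqP e0.
  have : gen_init G \in subset_init by rewrite inE connect0.
  by rewrite e0 inE.
rewrite gen_run_rcons IHt -cats1 foldl_cat /=.
case: ifP => [//|/negbFE/eqP ->] /=.
case: ifP => // /set0Pn[r]; rewrite inE => /andP[_ /existsP[q]].
by rewrite inE.
Qed.

Lemma subset_genP : is_projected_generator T G subset_gen.
Proof.
split=> //; apply/seteqP; split=> t; rewrite /gen_lang /gen_mlang /lproj /=.
- case=> X; rewrite subset_gen_run; case: ifP => // /set0Pn[r].
  by case/mem_subset=> w wr wt _; exists w => //; exists r.
- case=> w [r wr] wt; rewrite subset_gen_run.
  have rt : r \in foldl subset_step subset_init t by apply/mem_subset; exists w.
  rewrite ifT; first by eexists.
  by apply/set0Pn; exists r.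
- case=> X; rewrite subset_gen_run; case: ifP => // _ [<-].
  rewrite inE => /set0Pn[r]; rewrite inE => /andP[/mem_subset[w wr wt] rm].
  by exists w => //; exists r.
- case=> w [r wr rm] wt; rewrite subset_gen_run.
  have rt : r \in foldl subset_step subset_init t by apply/mem_subset; exists w.
  rewrite ifT; last by apply/set0Pn; exists r.
  by eexists=> //; rewrite inE; apply/set0Pn; exists r; rewrite inE rt.
Qed.

End Subset.
End Generators.

(* Main.v *)
(* Nonconflict: a word whose projections lie in the three closures is extended
   inside LC, the observer property lifts this extension to each supC_{i+k}, and
   since the two lifts share only events of A0 they merge into a single word.
   Controllability of the product of closures is then checked componentwise: an
   uncontrollable event is allowed first by supC_k, then by both supC_{i+k}, and
   finally by L_C. *)

Require Import Defs.
From mathcomp Require Import all_boot.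
From mathcomp Require Import boolp classical_sets.

Local Open Scope classical_set_scope.

Section Languages.

Set Implicit Arguments.
Unset Strict Implicit.

Variable E : finType.
Implicit Types (A B T U : {set E}) (M N L : language E) (s t u v : seq E).

Lemma proj_cat T s t : proj T (s ++ t) = proj T s ++ proj T t.
Proof. exact: filter_cat. Qed.

Lemma proj_proj A T s : proj A (proj T s) = proj (A :&: T) s.
Proof.
by rewrite /proj -filter_predI; apply: eq_filter => a; rewrite /= finset.in_setI.
Qed.

Lemma proj_projS A T s : A \subset T -> proj A (proj T s) = proj A s.
Proof. by move=> /finset.setIidPl AT; rewrite proj_proj AT. Qed.

Lemma projC A T s : proj A (proj T s) = proj T (proj A s).
Proof. by rewrite !proj_proj finset.setIC. Qed.

Lemma words_projT T s : words T (proj T s).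
Proof. exact: filter_all. Qed.

Lemma wordsS A B s : A \subset B -> words A s -> words B s.
Proof. by move=> /fintype.subsetP AB /allP As; apply/allP => a /As /AB. Qed.

Lemma words_cat A s t : words A (s ++ t) <-> words A s /\ words A t.
Proof. by rewrite /words /= all_cat; split=> /andP. Qed.

Lemma words_projK T s : words T s -> proj T s = s.
Proof. by move=> /all_filterP. Qed.

Lemma proj_words A T s : words A s -> proj T s = proj (T :&: A) s.
Proof. by move=> As; rewrite -proj_proj (words_projK As). Qed.

(** Built by induction on [v] from the right. A last letter [b] outside [A] is appended to the merge
    of [u] with the rest. A shared [b] also occurs in [u], as the last letter there that [B] keeps;
    the tail of [u] after it is erased by [B] and can be placed at the very end. *)
Lemma proj_merge A B u v : words A u -> words B v -> proj B u = proj A v ->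
  exists w, [/\ words (A :|: B) w, proj A w = u & proj B w = v].
Proof.
elim/last_ind: v u => [|v b IHv] u Au Bv uv.
  exists u; split; [|exact: words_projK|by []].
  exact: wordsS (finset.subsetUl _ _) Au.
move: Bv; rewrite /words /= all_rcons => /andP[/= bB Bv].
move: uv; rewrite proj_rcons; case: ifP => [bA|bA] uv; last first.
  have [w [ABw wA wB]] := IHv _ Au Bv uv; exists (rcons w b).
  by rewrite !proj_rcons bA bB wA wB all_rcons ABw /= finset.in_setU bB orbT.
have [u1 [u2 [eu _ u1v u2B]]] := proj_split uv; subst u.
move: Au; rewrite -cat_rcons => /words_cat[].
rewrite /words /= all_rcons => /andP[_ Au1] Au2.
have [w [ABw wA wB]] := IHv _ Au1 Bv u1v; exists (rcons w b ++ u2).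
rewrite !proj_cat !proj_rcons bA bB wA wB u2B cats0 words_projK //; split=> //.
apply/words_cat; rewrite /words /= all_rcons ABw /= finset.in_setU bB orbT.
by split=> //; apply: wordsS (finset.subsetUl _ _) Au2.
Qed.

Lemma prefix_closureI M : M `<=` prefix_closure M.
Proof. by move=> s Ms; exists [::]; rewrite cats0. Qed.

Lemma prefix_closure_id M : prefix_closure (prefix_closure M) = prefix_closure M.
Proof.
apply/seteqP; split; last exact: prefix_closureI.
by move=> s [u [v]]; rewrite -catA; exists (u ++ v).
Qed.

Lemma prefix_closureS M N : M `<=` N -> prefix_closure M `<=` prefix_closure N.
Proof. by move=> MN s [u /MN]; exists u. Qed.

Lemma prefix_closure_proj T M N s : (forall t, M t -> N (proj T t)) ->
  prefix_closure M s -> prefix_closure N (proj T s).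
Proof. by move=> MN [u /MN]; rewrite proj_cat; exists (proj T u). Qed.

Lemma controllableP M N U s a : controllable M N U ->
  prefix_closure M s -> a \in U -> N (rcons s a) -> prefix_closure M (rcons s a).
Proof. by move=> cM Ms aU Ns; apply: cM; split=> //; exists s => //; exists a. Qed.

(** An event outside [T] leaves the projection unchanged, so controllability for [T :&: U] handles
    every event of [U]. This lets each factor of a product treat global uncontrollable events
    uniformly. *)
Lemma controllable_proj M N T U s a : controllable M N (T :&: U) ->
  a \in U -> prefix_closure M (proj T s) -> N (proj T (rcons s a)) ->
  prefix_closure M (proj T (rcons s a)).
Proof.
move=> cM aU Ms; rewrite proj_rcons; case: ifP => // aT Ns.
by apply: controllableP cM Ms _ Ns; rewrite finset.in_setI aT.
Qed.

Lemma supC_sub M N U : supC M N U `<=` M `&` N.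
Proof. by move=> s [M' [M'N _] /M'N]. Qed.

(** Controllability survives unions: a prefix of a word of the union is a prefix of a word of a
    single member, and that member already contains the required extension in its closure. *)
Lemma supC_controllable M N U : controllable (supC M N U) N U.
Proof.
move=> _ [[s [u [M' M'P M's]] [a aU <-]] Ns].
have M'sup : M' `<=` supC M N U by move=> t M't; exists M'.
apply: prefix_closureS M'sup _ _; apply: controllableP M'P.2 _ aU Ns.
by exists u.
Qed.

(** Since [T] adds no letters to [A :|: B], the outer projection to [A :|: B] is the identity and
    the nested product flattens. *)
Lemma sync_coverE A M B N T L s : T \subset A :|: B ->
  sync (A :|: B) (sync A M B N) T L s <->
  [/\ words (A :|: B) s, M (proj A s), N (proj B s) & L (proj T s)].
Proof.
move=> TAB; rewrite /sync /= (finset.setUidPl TAB).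
by split=> [[ABs]|[ABs]]; rewrite (words_projK ABs); [case=> -[_ []]|].
Qed.

Section Nonconflict.
Variables (A B T : {set E}) (M N L : language E).
Hypotheses (TAB : T \subset A :|: B) (ABT : A :&: B \subset T).
Hypotheses (obsM : observer A T M) (obsN : observer B T N).
Hypothesis LMN : L `<=` sync (A :&: T) (lproj T M) (B :&: T) (lproj T N).

Lemma observer_nonconflict :
  prefix_closure (sync (A :|: B) (sync A M B N) T L) =
  sync (A :|: B) (sync A (prefix_closure M) B (prefix_closure N))
    T (prefix_closure L).
Proof.
apply/seteqP; split=> s.
  case=> u /sync_coverE -/(_ TAB)[/words_cat[ABs _] Ms Ns Ls].
  apply/sync_coverE => //; move: Ms Ns Ls; rewrite !proj_cat => Ms Ns Ls.
  by split=> //; eexists; eassumption.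
move=> /sync_coverE -/(_ TAB)[ABs Ms Ns [v Lv]].
(* Here [v] completes the [T]-projection of [s] inside [L]; [LMN] makes the shares of the completed
   word in [A] and [B] projections of words of [M] and [N], which are the targets for the two
   observers. *)
have [/words_cat[_ wv] [Mv Nv]] := LMN Lv.
have Tv : words T v.
  by apply: wordsS wv; rewrite finset.subUset !finset.subsetIr.
have projTv C : proj (C :&: T) (proj T s ++ v) = proj T (proj C s) ++ proj C v.
  rewrite -proj_proj [proj T (_ ++ _)]words_projK; first by rewrite proj_cat projC.
  by apply/words_cat; split=> //; apply: words_projT.
rewrite !projTv in Mv Nv.
have [u1 [Au1 Mu1]] := obsM Mv Ms (prefix_prefix _ _).
rewrite proj_cat => /eqP; rewrite eqseq_cat // eqxx => /eqP u1v.
have [u2 [Bu2 Nu2]] := obsN Nv Ns (prefix_prefix _ _).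
rewrite proj_cat => /eqP; rewrite eqseq_cat // eqxx => /eqP u2v.
(* Merging goes through [v]: first [u1] with [v] over [A :|: T], then the result with [u2], so that
   the final word has all three prescribed projections. *)
have [w1 [w1AT w1A w1T]] := proj_merge Au1 Tv u1v.
(* As [A :&: B] lies in [T], the alphabets [A :|: T] and [B] share exactly [B :&: T], where both
   words project to [proj B v]. *)
have w1B : proj B w1 = proj (A :|: T) u2.
  rewrite (proj_words B w1AT) (proj_words _ Bu2) finset.setIUr finset.setIUl.
  rewrite [B :&: A]finset.setIC !(finset.setUidPr _) ?finset.subsetI ?ABT
    ?finset.subsetIl ?finset.subsetIr //.
  by rewrite -proj_proj w1T -u2v -proj_words.
have [w [wABT wAT wB]] := proj_merge w1AT Bu2 w1B.
have wA : proj A w = u1 by rewrite -w1A -wAT proj_projS // finset.subsetUl.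
have wT : proj T w = v by rewrite -w1T -wAT proj_projS // finset.subsetUr.
exists w; apply/sync_coverE => //.
rewrite !proj_cat wA wB wT; split=> //; apply/words_cat; split=> //.
apply: wordsS wABT; rewrite !finset.subUset TAB finset.subsetUl.
by rewrite finset.subsetUr.
Qed.

End Nonconflict.

End Languages.

Theorem theorem8 (E : finType) (A1 A2 Ak A0 Au : {set E})
    (G1 G2 PG1 PG2 : generator E) (K : language E) :
  let A := A1 :|: A2 in
  let A1k := A1 :|: Ak in
  let A2k := A2 :|: Ak in
  let Gk := sync_gen PG1 PG2 in
  let supCk := supC (lproj Ak K) (gen_lang Gk) (Ak :&: Au) in
  let supC1k :=
    supC (lproj A1k K) (sync A1 (gen_lang G1) Ak (prefix_closure supCk))
      (A1k :&: Au) in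
  let supC2k :=
    supC (lproj A2k K) (sync A2 (gen_lang G2) Ak (prefix_closure supCk))
      (A2k :&: Au) in
  let P1 := lproj A0 supC1k in
  let P2 := lproj A0 supC2k in
  let LC :=
    supC (sync (A1k :&: A0) P1 (A2k :&: A0) P2)
      (sync (A1k :&: A0) (prefix_closure P1) (A2k :&: A0) (prefix_closure P2))
      (A0 :&: Au) in
  gen_events G1 = A1 ->
  gen_events G2 = A2 ->
  Au \subset A ->
  A1 :&: A2 \subset Ak ->
  Ak \subset A ->
  is_projected_generator Ak G1 PG1 ->
  is_projected_generator Ak G2 PG2 ->
  cond_independent G1 G2 Gk ->
  regular K ->
  K `<=` gen_mlang (sync_gen (sync_gen G1 G2) Gk) ->
  cond_decomposable A1 A2 Ak K ->
  cond_decomposable A1 A2 Ak (prefix_closure K) ->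
  Ak \subset A0 ->
  A0 \subset A ->
  observer A1k A0 supC1k ->
  observer A2k A0 supC2k ->
  let supC12_LC := sync (A1k :|: A2k) (sync A1k supC1k A2k supC2k) A0 LC in
  prefix_closure supC12_LC =
    sync (A1k :|: A2k)
      (sync A1k (prefix_closure supC1k) A2k (prefix_closure supC2k))
      A0 (prefix_closure LC) /\
  controllable (prefix_closure supC12_LC)
    (sync A1 (gen_lang G1) A2 (gen_lang G2)) Au.
Proof.
move=> A A1k A2k Gk supCk supC1k supC2k P1 P2 LC eG1 eG2 AuA A12 AkA.
move=> [ePG1 LPG1 _] [ePG2 LPG2 _] _ _ _ _ _ AkA0 A0A obs1 obs2 supC12_LC.
have AE : A1k :|: A2k = A.
  rewrite /A1k /A2k -finset.setUUl; exact/finset.setUidPl.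
have A0cov : A0 \subset A1k :|: A2k by rewrite AE.
have nonconflict : prefix_closure supC12_LC = sync (A1k :|: A2k)
    (sync A1k (prefix_closure supC1k) A2k (prefix_closure supC2k))
    A0 (prefix_closure LC).
  apply: observer_nonconflict => //.
  (* The shared events are [(A1 :&: A2) :|: Ak], and both parts lie in [Ak], hence in [A0]. *)
  - by rewrite /A1k /A2k -finset.setUIl finset.subUset (fintype.subset_trans A12).
  - by move=> s LCs; have [] := supC_sub LCs.
split=> // _ [[s + [a aU <-]] [Asa [L1 L2]]].
rewrite prefix_closure_id nonconflict.
move=> /sync_coverE -/(_ A0cov)[As s1 s2 s0].
have aU' : a \in Au by [].
(* The plant of [supC1k] contains the factor [prefix_closure supCk], so a prefix of a word of
   [supC1k] projects into it. *)
have sk : prefix_closure supCk (proj Ak s).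
  rewrite -(proj_projS _ (finset.subsetUr A1 Ak)) -prefix_closure_id.
  by apply: prefix_closure_proj s1 => t M1t; have [_ [_ []]] := supC_sub M1t.
(* The factor [PG1] of the coordinator has alphabet [A1 :&: Ak], hence the projection tested
   here. *)
have L1k : lproj Ak (gen_lang G1) (proj (A1 :&: Ak) (rcons s a)).
  by exists (proj A1 (rcons s a)); rewrite // projC proj_proj.
have L2k : lproj Ak (gen_lang G2) (proj (A2 :&: Ak) (rcons s a)).
  by exists (proj A2 (rcons s a)); rewrite // projC proj_proj.
have ska : prefix_closure supCk (proj Ak (rcons s a)).
  apply: controllable_proj (@supC_controllable _ _ _ _) aU' sk _.
  rewrite gen_lang_sync ePG1 ePG2 LPG1 LPG2 eG1 eG2 /sync /=.
  rewrite !proj_projS ?finset.subsetIr // -finset.setIUl (finset.setIidPr AkA).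
  by split=> //; apply: words_projT.
(* The plant of [supC1k] accepts the extended word: [L1] gives the [G1] factor and [ska] the
   coordinator factor. *)
have s1a : prefix_closure supC1k (proj A1k (rcons s a)).
  apply: controllable_proj (@supC_controllable _ _ _ _) aU' s1 _.
  rewrite /sync /= !proj_projS ?finset.subsetUl ?finset.subsetUr //.
  by split=> //; apply: words_projT.
have s2a : prefix_closure supC2k (proj A2k (rcons s a)).
  apply: controllable_proj (@supC_controllable _ _ _ _) aU' s2 _.
  rewrite /sync /= !proj_projS ?finset.subsetUl ?finset.subsetUr //.
  by split=> //; apply: words_projT.
apply/sync_coverE => //; split=> //; first by rewrite AE.
apply: controllable_proj (@supC_controllable _ _ _ _) aU' s0 _.
rewrite /sync /= !proj_projS ?finset.subsetIr // -finset.setIUl AE.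
rewrite (finset.setIidPr A0A); split; first exact: words_projT.
(* Commuting the projections turns membership in the plant of [LC] into the images under [A0] of
   [s1a] and [s2a]. *)
rewrite -!proj_proj ![proj _ (proj A0 _)]projC.
by split; [move: s1a | move: s2a]; apply: prefix_closure_proj => t Mt; exists t.
Qed.
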